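(* Let $T>0$, $c_1>c_2>0$ and $a\in(0,1)$. For $b>0$ let $$\pi_T(ab,b):=\mathbb{P}\left(\sup_{t\in[0,T]}(B(t)-c_1t)>ab,\ \sup_{t\in[0,T]}(B(t)-c_2t)>b\right),$$ where $\{B(t):t\ge 0\}$ is a standard Brownian motion. Then, as $b\to\infty$, $$\pi_T(ab,b)=\sqrt{\frac{2T}{\pi}}\,\frac{1}{b}\,e^{-\frac{(b+c_2T)^2}{2T}}\,(1+o(1)).$$
   Context: $f(b)=g(b)(1+o(1))$ as $b\to\infty$ means $\lim_{b\to\infty}f(b)/g(b)=1$. On the right-hand side, $\pi$ without a subscript denotes the number $3.14159\ldots$. A standard Brownian motion starts at $B(0)=0$. *)

(* Defs.v *)
From HB Require Import structures.
From mathcomp Require Import all_boot all_order all_algebra.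
From mathcomp Require Import all_classical all_reals all_analysis.

Set Implicit Arguments.
Unset Strict Implicit.
Unset Printing Implicit Defensive.

Import Order.TTheory GRing.Theory Num.Theory.
Import numFieldNormedType.Exports.
Local Open Scope classical_set_scope.
Local Open Scope ring_scope.

(* Mutual independence of a finite family. Since [A i] may be [setT], the
   product rule for the whole family contains the one for every subfamily. *)
Definition mutually_independent (R : realType) (d : measure_display)
    (Omega : measurableType d) (P : probability Omega R)
    (n : nat) (X : 'I_n -> Omega -> R) : Prop :=
  forall A : 'I_n -> set R, (forall i, measurable (A i)) ->
    P (\bigcap_i (X i @^-1` A i)) = (\prod_(i < n) P (X i @^-1` A i))%E.

(* Only the values [B t] with [0 <= t] are constrained.
   The second parameter of [normal_prob] is the standard deviation. *)
Record standard_brownian_motion (R : realType) (d : measure_display)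
    (Omega : measurableType d) (P : probability Omega R)
    (B : R -> {RV P >-> R}) : Prop := StandardBrownianMotion {
  sbm_start : forall w, B 0 w = 0 ;
  sbm_continuous : forall w,
    {within `[0, +oo[, continuous (fun t => B t w)} ;
  sbm_gaussian : forall s t, 0 <= s -> s < t ->
    forall A : set R, measurable A ->
      P ((fun w => B t w - B s w) @^-1` A) =
      normal_prob 0 (Num.sqrt (t - s)) A ;
  (* a finite sequence of times is the beginning of an infinite one *)
  sbm_independent : forall (n : nat) (t : nat -> R),
    0 <= t 0 -> nondecreasing_seq t ->
    mutually_independent P (fun (i : 'I_n) w => B (t i.+1) w - B (t i) w) }.

(* By path continuity the real supremum is that of a nonempty bounded set. *)
Definition sup_drifted (R : realType) (d : measure_display)
    (Omega : measurableType d) (P : probability Omega R)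
    (B : R -> {RV P >-> R}) (T c : R) (w : Omega) : R :=
  sup [set B t w - c * t | t in `[0, T]].

Definition joint_ruin_prob (R : realType) (d : measure_display)
    (Omega : measurableType d) (P : probability Omega R)
    (B : R -> {RV P >-> R}) (T c1 c2 x y : R) : R :=
  fine (P [set w | x < sup_drifted B T c1 w /\ y < sup_drifted B T c2 w]).

(* Main.v *)
Require Import Defs.
From HB Require Import structures.
From mathcomp Require Import all_boot all_order all_algebra.
From mathcomp Require Import all_classical all_reals all_analysis.
From mathcomp Require Import measurable_realfun normal_distribution ring lra.
Import Order.TTheory GRing.Theory Num.Theory.
Import numFieldNormedType.Exports.
Local Open Scope classical_set_scope.
Local Open Scope ring_scope.

Set Implicit Arguments.
Unset Strict Implicit.
Unset Printing Implicit Defensive.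

(** Once [(c1 - c2) * T <= (1 - a) * b], a time [s] at which [B s - c2 * s]
    exceeds [b] is also a time at which [B s - c1 * s] exceeds [a * b]: the
    steeper drift costs at most [(c1 - c2) * T].  The joint event is then the
    single crossing event of the barrier [b + c2 * s] ([joint_ruin_probE]), so
    everything rests on the law of the maximum of Brownian motion with drift
    [- c], [c = c2], over [0, T].

    That law is obtained exactly, by a reflection argument that needs neither a
    stopping time in continuous time nor a change of measure.  Let
    [h y = 1 + exp (- 2 c y)] for [y < 0] and [h y = 0] otherwise
    ([reflection_weight]), and let [Y s = b + c * s - B s] be the gap below the
    barrier.  Two facts about [h] carry the proof: [h] is nonincreasing, and a
    gap started at 0 satisfies [E (h (c * s - B s)) = 1] for every [s > 0]
    ([integral_reflection_weight_barrier]), because the factor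
    [exp (- 2 c y)] turns the normal density centred at [c * s] into the one
    centred at [- c * s].

    On a finite time grid, let [E_k] be the event that the gap is negative for
    the first time at [t k].  There [h (Y T)] is at least [h] of the same
    increment started from 0, and that increment is independent of [E_k];
    summing over [k], the probability of a crossing on the grid is at most
    [E (h (Y T))] ([discrete_crossing_le]).  Raising the barrier by [e] reverses
    the inequality on the paths that do not overshoot by more than [e]
    ([discrete_crossing_ge]).  By uniform continuity every path overshoots by
    less than [e] on fine grids, so Fatou's lemma, applied first to the mesh and
    then to [e], gives
      [P (crossing b) = E (h (Y T))]
    ([crossing_integral]).

    The right-hand side is a sum of two normal tails ([crossing_probE]).  The
    weight [exp (- 2 c b)] of the second tail gives both terms the same
    exponential factor, and the Mills ratio bounds [normal_tail_le] and
    [normal_tail_ge] make each of them equivalent to one half of the claimed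
    rate. *)

(** * Normal laws: density, reflection and Mills ratio *)

(** The density is the Radon-Nikodym derivative of the law up to a null set, so
    that the general change of variables applies without any integrability. *)
Lemma ge0_integral_normal_prob (R : realType) (m s : R) (f : R -> \bar R) :
  measurable_fun [set: R] f -> (forall x, 0 <= f x)%E ->
  (\int[normal_prob m s]_x f x =
   \int[lebesgue_measure]_x (f x * (normal_pdf m s x)%:E))%E.
Proof.
move=> mf f0.
have dom := normal_prob_dominates m s.
have mpdf : measurable_fun [set: R] (EFin \o normal_pdf m s).
  by apply/measurable_EFinP; exact: measurable_normal_pdf.
rewrite -(Radon_Nikodym_SigmaFinite.change_of_variables dom)//.
have iRN := Radon_Nikodym_SigmaFinite.f_integrable dom.
apply: ae_eq_integral => //.
- by apply: emeasurable_funM => //; exact: (measurable_int _ iRN).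
- exact: emeasurable_funM.
- apply: ae_eqe_mul2l => /=; apply: integral_ae_eq => // E _ mE.
  by rewrite -(Radon_Nikodym_SigmaFinite.f_integral dom).
Qed.

Lemma measurable_EFin_normal_pdf (R : realType) (m s : R) (D : set R) :
  measurable_fun D (fun x : R => (normal_pdf m s x)%:E).
Proof.
by apply: measurable_funTS; apply/measurable_EFinP; exact: measurable_normal_pdf.
Qed.

Lemma lebesgue_measure_reflection (R : realType) (p : R) (A : set R) :
  measurable A ->
  pushforward lebesgue_measure ((fun x => p - x) : R -> measurableTypeR R) A =
  lebesgue_measure A.
Proof.
move=> mA.
have mrefl : measurable_fun [set: R] ((fun x => p - x) : R -> measurableTypeR R).
  exact: measurable_funB.
apply/esym; pose mp := HB.pack_for {mfun R >-> measurableTypeR R}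
  ((fun x => p - x) : R -> measurableTypeR R) (isMeasurableFun.Build _ _ _ _ _ mrefl).
apply: (lebesgue_measure_unique (mu := pushforward lebesgue_measure mp)) => //= _ [[a b]] _ <-.
rewrite /pushforward /=.
rewrite (_ : _ @^-1` _ = `[p - b, p - a[%classic); last first.
  by apply/seteqP; split => x /=; rewrite !in_itv/= => /andP[? ?]; apply/andP; split; lra.
rewrite !lebesgue_measure_itv/= !lte_fin ltrD2l ltrN2.
by case: ifP => // _; rewrite -!EFinB; congr (_%:E); ring.
Qed.

(** The density centred at [p] is the mirror image, about [p / 2], of the centred
    density. *)
Lemma normal_prob_reflection (R : realType) (p m s : R) : s != 0 ->
  normal_prob p s `]m, +oo[ = normal_prob 0 s `]-oo, (p - m)[ :> \bar R.
Proof.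
move=> s0; rewrite /normal_prob.
under eq_integral => x _.
  rewrite (_ : normal_pdf p s x = normal_pdf 0 s (p - x)); last first.
    rewrite !normal_pdfE// /normal_fun subr0.
    by rewrite (_ : (x - p) ^+ 2 = (p - x) ^+ 2) // -sqrrN opprB.
  over.
have mrefl : measurable_fun [set: measurableTypeR R]
    ((fun x => p - x) : measurableTypeR R -> measurableTypeR R).
  exact: (@measurable_funB _ (measurableTypeR R)).
have -> : `]m, +oo[%classic = (fun x : R => p - x) @^-1` `]-oo, (p - m)[.
  by apply/seteqP; split => x /=; rewrite !in_itv/= ?andbT => ?; lra.
rewrite -(ge0_integral_pushforward mrefl lebesgue_measure
  (D := `]-oo, (p - m)[) (f := fun x => (normal_pdf 0 s x)%:E)).
- by apply: eq_measure_integral => A mA _; exact: lebesgue_measure_reflection.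
- by [].
- exact: measurable_EFin_normal_pdf.
- by move=> x _; rewrite lee_fin normal_pdf_ge0.
Qed.

Lemma continuous_normal_tail (R : realType) (p s m : R) : 0 < s -> p < m ->
  {within `[m, +oo[, continuous
    (fun x : R => normal_pdf p (Num.sqrt s) x * (1 + s / (x - p) ^+ 2))}.
Proof.
move=> s0 pm; have ss0 : Num.sqrt s != 0 by rewrite gt_eqF ?sqrtr_gt0.
apply: continuous_in_subspaceT => x; rewrite inE/= in_itv/= andbT => mx.
have xp : x - p != 0 by rewrite gt_eqF// subr_gt0 (lt_le_trans pm).
apply: cvgM; first exact: continuous_normal_pdf.
apply: cvgD; first exact: cvg_cst.
apply: cvgM; first exact: cvg_cst.
apply: cvgV; first by rewrite expf_neq0.
apply: (cvg_comp (fun x => x - p) (fun x => x ^+ 2)); last exact: sqr_continuous.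
by apply: cvgB; [exact: cvg_id|exact: cvg_cst].
Qed.

(** With the correction factor [1 + s / (x - p) ^+ 2] the normal density has the
    elementary primitive [- s / (x - p)] times itself; both Mills bounds follow
    by comparing this factor with constants. *)
Lemma normal_tail_FTC (R : realType) (p s m : R) : 0 < s -> p < m ->
  (\int[lebesgue_measure]_(x in `[m, +oo[)
     (normal_pdf p (Num.sqrt s) x * (1 + s / (x - p) ^+ 2))%:E =
   (normal_peak (Num.sqrt s) * (s / (m - p)) *
     expR (- ((m - p) ^+ 2 / (2 * s))))%:E)%E.
Proof.
move=> s0 pm; have ss0 : Num.sqrt s != 0 by rewrite gt_eqF ?sqrtr_gt0.
set k := normal_peak _.
have k0 : 0 < k by exact: normal_peak_gt0.
have pdfE x : normal_pdf p (Num.sqrt s) x = k * expR (- ((x - p) ^+ 2 / (2 * s))).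
  rewrite normal_pdfE// /normal_fun sqr_sqrtr ?ltW//; congr (_ * expR _).
  by rewrite mulNr mulr_natl.
pose F (x : R) := - (k * (s / (x - p)) * expR (- ((x - p) ^+ 2 / (2 * s)))).
have dF (x : R) : m <= x -> is_derive x (1 : R) F
    (normal_pdf p (Num.sqrt s) x * (1 + s / (x - p) ^+ 2)).
  move=> mx; have xp : x - p != 0 by rewrite gt_eqF// subr_gt0 (lt_le_trans pm).
  pose u (y : R) : R := y - p.
  pose q (y : R) : R := - ((y - p) ^+ 2 / (2 * s)).
  have Du : is_derive x (1 : R) u 1.
    have := is_deriveB (is_derive_id x (1 : R)) (is_derive_cst p x (1 : R)).
    by move=> /is_derive_eq; apply; rewrite subr0.
  have DV := @is_deriveV _ u x 1 1 xp Du.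
  have Dq : is_derive x (1 : R) q (- ((x - p) / s)).
    have := is_deriveM (is_deriveM Du Du) (is_derive_cst (- (2 * s)^-1) x (1 : R)).
    rewrite (_ : (_ * _) = q); last first.
      by apply/funext => y /=; rewrite /q !fctE expr2 mulrN.
    move=> /is_derive_eq; apply.
    have s00 : s != 0 by rewrite gt_eqF.
    (* the scaling [*:] of the derivative rules is multiplication *)
    transitivity (u x * u x * 0 + - (2 * s)^-1 * (u x * 1 + u x * 1)); first by [].
    by rewrite /u; field.
  have De := @is_derive1_comp _ expR q x _ _ (is_derive_expR (q x)) Dq.
  have := is_deriveM (is_deriveM DV De) (is_derive_cst (- (k * s)) x (1 : R)).
  rewrite (_ : (_ * _) = F); last first.
    by apply/funext => y /=; rewrite /F !fctE /= /u /q; ring.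
  move=> /is_derive_eq; apply.
  transitivity ((u x)^-1 * expR (q x) * 0 +
    - (k * s) * ((u x)^-1 * (expR (q x) * - ((x - p) / s)) +
                 expR (q x) * (- (u x) ^- 2 * 1))); first by [].
  have s00 : s != 0 by rewrite gt_eqF.
  by rewrite pdfE /u /q; set e := expR _; field; rewrite xp.
rewrite (@ge0_continuous_FTC2y _ _ F m 0).
- by rewrite sub0e -EFinN /F opprK.
- move=> x mx; rewrite mulr_ge0 ?normal_pdf_ge0// addr_ge0// divr_ge0 ?sqr_ge0//.
  exact: ltW.
- exact: continuous_normal_tail.
- rewrite -[X in _ --> X]oppr0; apply: cvgN.
  apply: (@squeeze_cvgr _ _ _ _ (cst 0) (fun x => (k * s) * (x - p)^-1)).
  + near=> x; have xp : 0 < x - p.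
      by rewrite subr_gt0; near: x; apply: nbhs_pinfty_gt; exact: num_real.
    rewrite mulr_ge0 ?expR_ge0 ?mulr_ge0 ?mulr_ge0 ?invr_ge0 ?(ltW k0) ?(ltW s0) ?(ltW xp)//=.
    rewrite mulrA ler_piMr ?mulr_ge0 ?mulr_ge0 ?invr_ge0 ?(ltW k0) ?(ltW s0) ?(ltW xp)//.
    by rewrite -[leRHS]expR0 ler_expR oppr_le0 divr_ge0 ?sqr_ge0 ?mulr_ge0 ?(ltW s0).
  + exact: cvg_cst.
  + rewrite -[X in _ --> X](mulr0 (k * s)); apply: cvgM; first exact: cvg_cst.
    have pos : \forall x \near +oo, 0 < x - p.
      by near=> x; rewrite subr_gt0; near: x; apply: nbhs_pinfty_gt; exact: num_real.
    by apply/(gtr0_cvgV0 pos); exact: cvg_addrr.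
- by move=> x mx; have [] := dF x (ltW mx).
- apply: cvg_at_right_filter.
  have [dFm _] := dF m (lexx _).
  by apply: differentiable_continuous; apply/derivable1_diffP.
- move=> x; rewrite in_itv/= andbT => mx.
  by rewrite derive1E; have [_ ->] := dF x (ltW mx).
Unshelve. all: by end_near.
Qed.

Lemma normal_tail_le (R : realType) (p s m : R) : 0 < s -> p < m ->
  (normal_prob p (Num.sqrt s) `]m, +oo[ <=
   (normal_peak (Num.sqrt s) * (s / (m - p)) *
     expR (- ((m - p) ^+ 2 / (2 * s))))%:E)%E.
Proof.
move=> s0 pm; rewrite -normal_tail_FTC// /normal_prob.
have mpdf D : measurable_fun D (fun x : R => (normal_pdf p (Num.sqrt s) x)%:E).
  exact: measurable_EFin_normal_pdf.
rewrite integral_itv_obnd_cbnd//.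
apply: ge0_le_integral => //=.
- by move=> x _; rewrite lee_fin normal_pdf_ge0.
- exact: mpdf.
- apply/measurable_EFinP; apply: subspace_continuous_measurable_fun => //.
  exact: continuous_normal_tail.
- move=> x _; rewrite lee_fin ler_peMr ?normal_pdf_ge0// lerDl divr_ge0 ?sqr_ge0//.
  exact: ltW.
Qed.

Lemma normal_tail_ge (R : realType) (p s m : R) : 0 < s -> p < m ->
  ((normal_peak (Num.sqrt s) * (s * (m - p) / ((m - p) ^+ 2 + s)) *
     expR (- ((m - p) ^+ 2 / (2 * s))))%:E <=
  normal_prob p (Num.sqrt s) `]m, +oo[)%E.
Proof.
move=> s0 pm.
have mp : 0 < m - p by rewrite subr_gt0.
have mp2 : 0 < (m - p) ^+ 2 by rewrite exprn_gt0.
set K := 1 + s / (m - p) ^+ 2.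
have K0 : 0 < K by rewrite addr_gt0// divr_gt0.
rewrite [X in (X%:E <= _)%E](_ : _ = K^-1 * (normal_peak (Num.sqrt s) * (s / (m - p)) *
    expR (- ((m - p) ^+ 2 / (2 * s))))); last first.
  by rewrite /K; field; rewrite (gt_eqF mp) (gt_eqF (addr_gt0 mp2 s0)).
rewrite EFinM -normal_tail_FTC// lee_pdivrMl// /normal_prob.
have mpdf D : measurable_fun D (fun x : R => (normal_pdf p (Num.sqrt s) x)%:E).
  exact: measurable_EFin_normal_pdf.
rewrite integral_itv_obnd_cbnd// -ge0_integralZl//; last 3 first.
- exact: mpdf.
- by move=> x _; rewrite lee_fin normal_pdf_ge0.
- by rewrite lee_fin ltW.
apply: ge0_le_integral => //=.
- move=> x _; rewrite lee_fin mulr_ge0 ?normal_pdf_ge0// addr_ge0// divr_ge0 ?sqr_ge0//.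
  exact: ltW.
- apply/measurable_EFinP; apply: subspace_continuous_measurable_fun => //.
  exact: continuous_normal_tail.
- by apply: emeasurable_funM => //; exact: mpdf.
- move=> x; rewrite in_itv/= andbT => mx; rewrite -EFinM lee_fin mulrC.
  rewrite ler_wpM2r ?normal_pdf_ge0// lerD2l ler_wpM2l ?(ltW s0)// lef_pV2 ?posrE//.
  + by rewrite ler_pXn2r ?nnegrE ?subr_ge0 ?lerB// ltW// (lt_le_trans pm).
  + by rewrite exprn_gt0// subr_gt0 (lt_le_trans pm).
Qed.

(** * The reflection weight *)

(** The indicator of a negative gap plus, on the same event, the ratio between the
    law of the gap reflected at the barrier and the law itself; for [c = 0] it is
    twice the indicator, as in the classical reflection principle.  The value 0
    at [y = 0] matches strict crossings. *)
Definition reflection_weight {R : realType} (c y : R) : R :=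
  if y < 0 then 1 + expR (- (2 * c * y)) else 0.

Lemma reflection_weight_ge0 (R : realType) (c y : R) :
  0 <= reflection_weight c y.
Proof. by rewrite /reflection_weight; case: ifP => // _; rewrite addr_ge0 ?expR_ge0. Qed.

Lemma reflection_weight_ge1 (R : realType) (c y : R) :
  y < 0 -> 1 <= reflection_weight c y.
Proof. by rewrite /reflection_weight => ->; rewrite lerDl expR_ge0. Qed.

Lemma reflection_weight_nincr (R : realType) (c : R) : 0 < c ->
  {homo reflection_weight c : x y / x <= y >-> y <= x}.
Proof.
move=> c0 x y xy; rewrite /reflection_weight.
case: (ltP y 0) => y0; last by case: ifP => // _; rewrite addr_ge0 ?expR_ge0.
by rewrite (le_lt_trans xy y0) lerD2l ler_expR lerN2 ler_wpM2l// mulr_ge0// ltW.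
Qed.

Lemma measurable_reflection_weight (R : realType) (c : R) :
  measurable_fun [set: R] (reflection_weight c).
Proof.
apply: measurable_fun_ifT => //.
- exact: measurable_fun_ltr.
- apply: measurable_funD => //; apply: measurableT_comp => //.
  by apply: measurableT_comp => //; exact: measurable_funM.
Qed.

(** The exponential weight tilts the centred normal law into the one with mean
    [2 * c * s]. *)
Lemma integral_reflection_weight (R : realType) (c s m : R) : 0 < s ->
  (\int[normal_prob 0 (Num.sqrt s)]_v (reflection_weight c (m - v))%:E =
   normal_prob 0 (Num.sqrt s) `]m, +oo[ +
   (expR (- (2 * c * (m - c * s))))%:E *
     normal_prob (2 * c * s) (Num.sqrt s) `]m, +oo[)%E.
Proof.
move=> s0; have ss0 : Num.sqrt s != 0 by rewrite gt_eqF ?sqrtr_gt0.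
have mpdf p : measurable_fun `]m, +oo[
    (fun x : measurableTypeR R => (normal_pdf p (Num.sqrt s) x)%:E).
  exact: measurable_EFin_normal_pdf.
have mw : measurable_fun [set: R] (fun v => reflection_weight c (m - v)).
  apply: measurableT_comp; first exact: measurable_reflection_weight.
  exact: measurable_funB.
rewrite ge0_integral_normal_prob; last 2 first.
- exact/measurable_EFinP.
- by move=> x; rewrite lee_fin reflection_weight_ge0.
rewrite /normal_prob -ge0_integralZl//; last 2 first.
- exact: mpdf.
- by move=> x _; rewrite lee_fin normal_pdf_ge0.
rewrite -ge0_integralD//; last 4 first.
- by move=> x _; rewrite lee_fin normal_pdf_ge0.
- exact: mpdf.
- by move=> x _; rewrite mule_ge0// lee_fin ?expR_ge0 ?normal_pdf_ge0.
- by apply: emeasurable_funM => //; exact: mpdf.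
rewrite [RHS]integral_mkcond; apply: eq_integral => x _.
rewrite patchE /reflection_weight.
have -> : (x \in `]m, +oo[%classic) = (m - x < 0).
  by apply/idP/idP; rewrite inE/= in_itv/= andbT => ?; lra.
case: ifP => // _; last by rewrite mul0e.
rewrite -EFinM -EFinM -EFinD; congr (_%:E).
rewrite !normal_pdfE// /normal_fun sqr_sqrtr ?ltW//.
rewrite mulrDl mul1r; congr (_ + _).
rewrite mulrCA [RHS]mulrCA; congr (_ * _); rewrite -!expRD; congr expR.
have s0' : s != 0 by rewrite gt_eqF.
by field.
Qed.

(** Started on the barrier, the two tails of [integral_reflection_weight] are the
    two complementary halves of one normal law. *)
Lemma integral_reflection_weight_barrier (R : realType) (c s : R) : 0 < s ->
  (\int[normal_prob 0 (Num.sqrt s)]_v (reflection_weight c (c * s - v))%:E = 1)%E.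
Proof.
move=> s0; have ss0 : Num.sqrt s != 0 by rewrite gt_eqF ?sqrtr_gt0.
rewrite integral_reflection_weight// subrr mulr0 oppr0 expR0 mul1e.
rewrite [X in (_ + X)%E]normal_prob_reflection//.
rewrite (_ : 2 * c * s - c * s = c * s); last by ring.
rewrite [X in (_ + X)%E]integral_itv_bndo_bndc; last first.
  exact: measurable_EFin_normal_pdf.
rewrite -[RHS](integral_normal_pdf 0 (Num.sqrt s)) addeC.
rewrite -ge0_integral_setU//.
- by congr (integral _ _ _); apply/seteqP; split => x //= _;
    rewrite !in_itv/= andbT; case: (leP x (c * s)) => ?; [left|right].
- exact: measurable_EFin_normal_pdf.
- by move=> x _; rewrite lee_fin normal_pdf_ge0.
- apply/disj_setPS => x [] /=; rewrite !in_itv/= andbT => xc.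
  by rewrite ltNge xc.
Qed.

(** The weight jumps at 0 and is right-continuous there; this is why the barrier
    is approached from above. *)
Lemma reflection_weight_cvg_right (R : realType) (c y : R) :
  reflection_weight c (y + n.+1%:R^-1) @[n --> \oo] --> reflection_weight c y.
Proof.
have to_y : y + n.+1%:R^-1 @[n --> \oo] --> y.
  rewrite -[X in _ --> X]addr0; apply: cvgD; first exact: cvg_cst.
  exact: cvg_harmonic.
case: (ltP y 0) => y0; last first.
  apply: cvg_near_cst; apply: nearW => n.
  by rewrite /reflection_weight !ltNge y0 addr_ge0.
have -> : reflection_weight c y = 1 + expR (- (2 * c * y)).
  by rewrite /reflection_weight y0.
have near_neg : \forall n \near \oo, y + n.+1%:R^-1 < 0.
  exact: (cvgr_lt y to_y).
apply: (@cvg_trans _ ((1 + expR (- (2 * c * (y + n.+1%:R^-1)))) @[n --> \oo])).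
  apply: near_eq_cvg; apply: filterS near_neg => n yn.
  by rewrite /reflection_weight yn.
apply: cvgD; first exact: cvg_cst.
apply: (cvg_comp _ expR); last exact: continuous_expR.
apply: cvgN; apply: cvgM; [exact: cvg_cst|exact: to_y].
Qed.

(** * Independence of an increment and the past *)

(** A pi-system generating the history of the path at the times [t 0, ..., t k]. *)
Definition past_cylinders {R : realType} {d : measure_display}
    {Omega : measurableType d} (B : R -> Omega -> R) (t : nat -> R) (k : nat) :
    set (set Omega) :=
  [set E | exists2 A : nat -> set R, (forall i, measurable (A i)) &
    E = \bigcap_(i in `I_k) ((fun w => B (t i.+1) w - B (t i) w) @^-1` A i)].

Lemma integral_mrestrT d (T : measurableType d) (R : realType)
    (mu : {measure set T -> \bar R}) (E : set T) (mE : measurable E)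
    (g : T -> \bar R) :
  measurable_fun [set: T] g -> (forall x, 0 <= g x)%E ->
  (\int[mrestr mu mE]_x g x = \int[mu]_(x in E) g x)%E.
Proof.
move=> mg g0; rewrite -(setUv E) ge0_integral_setU//; last 3 first.
- exact: measurableC.
- by rewrite setUv.
- by rewrite disj_set2E setICr.
rewrite (@null_set_integral _ _ _ (mrestr mu mE) (~` E))//.
- rewrite adde0; apply: eq_measure_integral => A mA AE.
  by rewrite /= /mrestr setIidl.
- exact: measurableC.
- exact: measurable_funTS.
- by rewrite /= /mrestr setICl measure0.
Qed.

Section independence.
Context (R : realType) (d : measure_display) (Omega : measurableType d).
Context (P : probability Omega R) (B : R -> {RV P >-> R}).
Context (hB : standard_brownian_motion B).

Let increment (s u : R) w := B u w - B s w.

Lemma measurable_increment (s u : R) : measurable_fun [set: Omega] (increment s u).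
Proof. exact: measurable_funB. Qed.

(** The increment from [t k] to [u] is appended to the first [k] increments of [t]
    by following [t] up to [k] and staying at [u] afterwards. *)
Lemma past_cylinders_indep (t : nat -> R) (k : nat) (u : R) (C : set R) E :
  0 <= t 0%N -> nondecreasing_seq t -> t k <= u -> measurable C ->
  past_cylinders B t k E ->
  (P (E `&` increment (t k) u @^-1` C) = P E * P (increment (t k) u @^-1` C))%E.
Proof.
move=> t0 tnd tku mC [A mA ->{E}].
pose t' i := if (i <= k)%N then t i else u.
have t'nd : nondecreasing_seq t'.
  move=> i j ij; rewrite /t'; case: ifPn => ik; case: ifPn => jk.
  - exact: tnd.
  - by rewrite (le_trans _ tku)// tnd.
  - by rewrite (leq_trans ij jk) in ik.
  - exact: lexx.
have t'0 : 0 <= t' 0%N by [].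
have indep (D : set R) : measurable D ->
    (P (\bigcap_(i in `I_k) (increment (t i) (t i.+1) @^-1` A i) `&`
        increment (t k) u @^-1` D) =
     (\prod_(i < k) P (increment (t i) (t i.+1) @^-1` A i)) *
     P (increment (t k) u @^-1` D))%E.
  move=> mD; pose A' (i : 'I_k.+1) := if (i < k)%N then A i else D.
  have mA' i : measurable (A' i) by rewrite /A'; case: ifP.
  have XE i : (i < k)%N -> increment (t' i) (t' i.+1) = increment (t i) (t i.+1).
    by move=> ik; rewrite /t' ik (ltnW ik).
  have XkE : increment (t' k) (t' k.+1) = increment (t k) u.
    by rewrite /t' leqnn ltnn.
  transitivity (P (\bigcap_(i in [set: 'I_k.+1]) (increment (t' i) (t' i.+1) @^-1` A' i))).
    congr (P _); apply/seteqP; split => w /=.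
      move=> [Aw Dw] i _; rewrite /A' /=.
      case: ltnP => ik; first by rewrite XE//; exact: Aw.
      have -> : nat_of_ord i = k by apply/eqP; rewrite eqn_leq ik -ltnS ltn_ord.
      by rewrite XkE.
    move=> AD; split.
      move=> i ik; have := AD (widen_ord (leqnSn k) (Ordinal ik)) I.
      by rewrite /A' /= ik XE.
    by have := AD ord_max I; rewrite /A' /= ltnn XkE.
  rewrite (sbm_independent hB t'0 t'nd mA') big_ord_recr /=; congr (_ * P _)%E.
    apply: eq_bigr => i _; congr (P _).
    by rewrite /A' /= ltn_ord -(XE _ (ltn_ord i)).
  by rewrite /A' /= ltnn -XkE.
rewrite indep//; congr (_ * _)%E.
have := indep setT measurableT.
by rewrite preimage_setT setIT probability_setT mule1 => <-.
Qed.

Lemma setI_closed_past_cylinders (t : nat -> R) k :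
  setI_closed (past_cylinders B t k).
Proof.
move=> _ _ [A mA ->] [C mC ->]; exists (fun i => A i `&` C i).
  by move=> i; exact: measurableI.
by rewrite -bigcapI.
Qed.

Lemma past_cylinders_measurable (t : nat -> R) k :
  past_cylinders B t k `<=` measurable.
Proof.
move=> _ [A mA ->]; apply: fin_bigcap_measurable => // i _.
by rewrite -[X in measurable X]setTI; exact: measurable_increment.
Qed.

(** Both sides are finite measures in [E] that agree on a pi-system. *)
Lemma past_indep (t : nat -> R) (k : nat) (u : R) (C : set R) E :
  0 <= t 0%N -> nondecreasing_seq t -> t k <= u -> measurable C ->
  <<s past_cylinders B t k >> E ->
  (P (E `&` increment (t k) u @^-1` C) = P E * P (increment (t k) u @^-1` C))%E.
Proof.
move=> t0 tnd tku mC sE.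
have mV : measurable (increment (t k) u @^-1` C).
  by rewrite -[X in measurable X]setTI; exact: measurable_increment.
have r0 : 0 <= fine (P (increment (t k) u @^-1` C)) by rewrite fine_ge0.
have scaleE F : mscale (NngNum r0) P F = (P F * P (increment (t k) u @^-1` C))%E.
  by rewrite /mscale /= fineK ?fin_num_measure// muleC.
rewrite -scaleE -[LHS]/(mrestr P mV E).
apply: (g_sigma_algebra_measure_unique (past_cylinders B t k) _ (fun=> setT)) => //.
- exact: past_cylinders_measurable.
- move=> _; exists (fun=> setT) => //.
  by apply/esym; rewrite -subTset => w _ i _.
- by rewrite bigcup_const//; exists 0%N.
- exact: setI_closed_past_cylinders.
- move=> F cF; transitivity (P F * P (increment (t k) u @^-1` C))%E.
    exact: past_cylinders_indep.
  exact/esym/scaleE.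
- by move=> _; rewrite /= /mrestr setTI; exact: (le_lt_trans (probability_le1 _ mV) (ltry _)).
Qed.

Lemma integral_past_indep (t : nat -> R) (k : nat) (u : R) (f : R -> \bar R) E :
  0 <= t 0%N -> nondecreasing_seq t -> t k < u ->
  <<s past_cylinders B t k >> E ->
  measurable_fun [set: R] f -> (forall x, 0 <= f x)%E ->
  (\int[P]_(w in E) f (B u w - B (t k) w)%R =
   P E * \int[normal_prob 0 (Num.sqrt (u - t k))]_x f x)%E.
Proof.
move=> t0 tnd tku sE mf f0.
have mE : measurable E.
  exact: (smallest_sub (@sigma_algebra_measurable _ Omega)
           (@past_cylinders_measurable t k)).
have r0 : 0 <= fine (P E) by rewrite fine_ge0.
rewrite -(integral_mrestrT P mE); last 2 first.
- by apply: measurableT_comp => //; exact: measurable_increment.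
- by move=> w; exact: f0.
pose V (w : Omega) : measurableTypeR R := B u w - B (t k) w.
have mV : measurable_fun [set: Omega] V by exact: measurable_increment.
rewrite -[LHS](@ge0_integral_pushforward _ _ _ _ _ _ mV (mrestr P mE) setT f) ?preimage_setT//.
rewrite -[P E]fineK ?fin_num_measure//.
rewrite -(ge0_integral_mscale (normal_prob 0 (Num.sqrt (u - t k))) measurableT (NngNum r0))//.
apply: eq_measure_integral => A mA _.
transitivity (P (E `&` (fun w => B u w - B (t k) w) @^-1` A)); first by rewrite setIC.
rewrite past_indep// ?(ltW tku)//.
transitivity (P E * normal_prob 0 (Num.sqrt (u - t k)) A)%E.
  congr (_ * _)%E; apply: (sbm_gaussian hB) => //.
  by rewrite (le_trans t0)// tnd.
by rewrite -[in LHS](fineK (fin_num_measure P E mE)).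
Qed.

End independence.

(** * Reflection along a discrete sequence of times *)

Section discrete_reflection.
Context (R : realType) (d : measure_display) (Omega : measurableType d).
Context (P : probability Omega R) (B : R -> {RV P >-> R}).
Context (hB : standard_brownian_motion B).
Context (t : nat -> R).
Context (t0 : t 0%N = 0) (tnd : nondecreasing_seq t).

Lemma past_measurable_path (j k : nat) : (j <= k)%N ->
  measurable_fun [set: g_sigma_algebraType (past_cylinders B t k)]
    (B (t j) : g_sigma_algebraType (past_cylinders B t k) -> R).
Proof.
elim: j => [_|j IH jk].
  rewrite (_ : (B (t 0%N) : Omega -> R) = cst 0); first exact: measurable_cst.
  by apply/funext => w; rewrite t0 (sbm_start hB).
rewrite (_ : (B (t j.+1) : Omega -> R) =
    (fun w => B (t j) w + (B (t j.+1) w - B (t j) w))); last first.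
  by apply/funext => w; rewrite addrC subrK.
apply: measurable_funD; first exact: IH (ltnW jk).
move=> _ C mC; rewrite setTI; apply: sub_sigma_algebra.
exists (fun i => if i == j then C else setT).
  by move=> i; case: ifP.
apply/seteqP; split => w /=; first by move=> Cw i ik; case: eqP => // ->.
by move=> /(_ j jk); rewrite eqxx.
Qed.

Definition gap (c b : R) (k : nat) (w : Omega) : R := b + c * t k - B (t k) w.

Lemma past_measurable_gap (c b : R) (j k : nat) (D : set R) : (j <= k)%N ->
  measurable D -> <<s past_cylinders B t k >> (gap c b j @^-1` D).
Proof.
move=> jk mD; rewrite -[X in <<s _ >> X]setTI.
suff : measurable_fun [set: g_sigma_algebraType (past_cylinders B t k)]
    (gap c b j : g_sigma_algebraType (past_cylinders B t k) -> R) by apply.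
by apply: measurable_funB => //; exact: past_measurable_path.
Qed.

Lemma past_measurable (k : nat) (E : set Omega) :
  <<s past_cylinders B t k >> E -> measurable E.
Proof.
exact: (smallest_sub (@sigma_algebra_measurable _ Omega)
  (@past_cylinders_measurable _ _ _ _ B t k)).
Qed.

Context (T c : R).
Context (c0 : 0 < c).

Let terminal (b : R) (w : Omega) : R := reflection_weight c (b + c * T - B T w).

Lemma measurable_terminal (b : R) : measurable_fun [set: Omega] (EFin \o terminal b).
Proof.
apply/measurable_EFinP; apply: measurableT_comp; first exact: measurable_reflection_weight.
exact: measurable_funB.
Qed.

(** Restarting the motion on the barrier at time [t k] gives the weight mean 1,
    independently of the past. *)
Lemma integral_restarted_weight (k : nat) (E : set Omega) : t k < T ->
  <<s past_cylinders B t k >> E ->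
  (\int[P]_(w in E)
     (reflection_weight c (c * (T - t k) - (B T w - B (t k) w)))%:E = P E)%E.
Proof.
move=> tkT sE.
rewrite (@integral_past_indep _ _ _ _ _ hB _ _ _
  (fun x => (reflection_weight c (c * (T - t k) - x))%:E))//.
- by rewrite integral_reflection_weight_barrier ?subr_gt0// mule1.
- by rewrite t0.
- apply/measurable_EFinP; apply: measurableT_comp; first exact: measurable_reflection_weight.
  exact: measurable_funB.
- by move=> x; rewrite lee_fin reflection_weight_ge0.
Qed.

Lemma measurable_restarted_weight (k : nat) (E : set Omega) :
  measurable_fun E (fun w =>
     (reflection_weight c (c * (T - t k) - (B T w - B (t k) w)))%:E).
Proof.
apply: measurable_funTS; apply/measurable_EFinP.
apply: measurableT_comp; first exact: measurable_reflection_weight.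
by apply: measurable_funB => //; exact: measurable_funB.
Qed.

(** Once the path is beyond the barrier, its gap at [T] is smaller than the one
    restarted from 0, and the weight is nonincreasing.  When [t k = T] nothing is
    left to restart, and the weight of a negative gap is at least 1 by itself. *)
Lemma past_beyond_le (b : R) (k : nat) (E : set Omega) : t k <= T ->
  <<s past_cylinders B t k >> E -> (forall w, E w -> gap c b k w < 0) ->
  (P E <= \int[P]_(w in E) (terminal b w)%:E)%E.
Proof.
move=> tkT sE Eb; have mE := past_measurable sE.
have [tT|] := eqVneq (t k) T.
  rewrite -(mul1e (P E)) -integral_cst//; apply: ge0_le_integral => //.
  - by apply: measurable_funTS; exact: measurable_terminal.
  - by move=> w Ew; rewrite lee_fin reflection_weight_ge1// -tT; exact: Eb.
move=> tT; have {tkT tT}tkT : t k < T by rewrite lt_neqAle tT.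
rewrite -(integral_restarted_weight tkT sE); apply: ge0_le_integral => //.
- by move=> w _; rewrite lee_fin reflection_weight_ge0.
- exact: measurable_restarted_weight.
- by apply: measurable_funTS; exact: measurable_terminal.
- move=> w /Eb; rewrite /gap => gw; rewrite lee_fin reflection_weight_nincr//.
  by lra.
Qed.

(** The comparison of [past_beyond_le] with the opposite sign; when [t k = T] the
    weight of a nonnegative gap is 0. *)
Lemma past_within_ge (b : R) (k : nat) (E : set Omega) : t k <= T ->
  <<s past_cylinders B t k >> E -> (forall w, E w -> 0 <= gap c b k w) ->
  (\int[P]_(w in E) (terminal b w)%:E <= P E)%E.
Proof.
move=> tkT sE Eb; have mE := past_measurable sE.
have [tT|] := eqVneq (t k) T.
  rewrite integral0_eq// => w /Eb; rewrite /gap tT => gw.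
  by rewrite /terminal /reflection_weight ltNge gw.
move=> tT; have {tkT tT}tkT : t k < T by rewrite lt_neqAle tT.
rewrite -[leRHS](integral_restarted_weight tkT sE); apply: ge0_le_integral => //.
- by move=> w _; rewrite lee_fin reflection_weight_ge0.
- by apply: measurable_funTS; exact: measurable_terminal.
- exact: measurable_restarted_weight.
- move=> w /Eb; rewrite /gap => gw; rewrite lee_fin reflection_weight_nincr//.
  by lra.
Qed.

Definition beyond (b : R) (k : nat) : set Omega := [set w | gap c b k w < 0].

Lemma past_first_beyond (b : R) (k : nat) :
  <<s past_cylinders B t k >> (seqDU (beyond b) k).
Proof.
have mb j : (j <= k)%N -> <<s past_cylinders B t k >> (beyond b j).
  move=> jk; rewrite (_ : beyond b j = gap c b j @^-1` `]-oo, 0[).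
    exact: past_measurable_gap.
  by apply/seteqP; split => w /=; rewrite in_itv.
apply: (@measurableD _ (g_sigma_algebraType (past_cylinders B t k))).
  exact: mb.
apply: (@bigsetU_measurable _ (g_sigma_algebraType (past_cylinders B t k))) => j _.
by apply: mb; exact: ltnW.
Qed.

(** The events that the gap is first negative at the [k]-th time split the
    crossing event, and [past_beyond_le] applies to each of them. *)
Lemma discrete_crossing_le (b : R) (n : nat) : (forall k, (k < n)%N -> t k <= T) ->
  (P (\big[setU/set0]_(k < n) beyond b k) <= \int[P]_w (terminal b w)%:E)%E.
Proof.
move=> tT; rewrite (bigsetU_seqDU (beyond b)).
have mF k : measurable (seqDU (beyond b) k).
  by apply: past_measurable; exact: past_first_beyond.
have tF (D : set nat) : trivIset D (seqDU (beyond b)).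
  exact: sub_trivIset (@trivIset_seqDU _ (beyond b)).
rewrite (@measure_bigsetU _ _ _ P (seqDU (beyond b)) mF (tF _)).
apply: (@le_trans _ _ (\sum_(k < n) \int[P]_(w in seqDU (beyond b) k) (terminal b w)%:E)%E).
  apply: lee_sum => k _; apply: past_beyond_le; first exact: tT.
    exact: past_first_beyond.
  by move=> w Fw; exact: (@subset_seqDU _ (beyond b) k w Fw).
have mt : measurable_fun [set: Omega] (fun w => (terminal b w)%:E) by exact: measurable_terminal.
rewrite -(big_mkord xpredT (fun k => \int[P]_(w in seqDU (beyond b) k) (terminal b w)%:E)%E).
rewrite -ge0_integral_bigsetU//.
- apply: ge0_subset_integral => //.
  + exact: bigsetU_measurable.
  + by move=> w _; rewrite lee_fin reflection_weight_ge0.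
- exact: iota_uniq.
- exact: measurable_funTS.
- by move=> w _; rewrite lee_fin reflection_weight_ge0.
Qed.

(** First passage beyond the barrier [b] that is not yet beyond the barrier
    [b + e]: an overshoot of at most [e]. *)
Definition first_beyond_near (b e : R) (k : nat) : set Omega :=
  seqDU (beyond b) k `&` [set w | 0 <= gap c (b + e) k w].

Lemma past_first_beyond_near (b e : R) (k : nat) :
  <<s past_cylinders B t k >> (first_beyond_near b e k).
Proof.
apply: (@measurableI _ (g_sigma_algebraType (past_cylinders B t k))).
  exact: past_first_beyond.
rewrite (_ : [set w | _] = gap c (b + e) k @^-1` `[0, +oo[).
  exact: past_measurable_gap.
by apply/seteqP; split => w /=; rewrite in_itv/= andbT.
Qed.

Lemma discrete_crossing_ge (b e : R) (n : nat) : (forall k, (k < n)%N -> t k <= T) ->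
  (\int[P]_(w in \big[setU/set0]_(k < n) first_beyond_near b e k) (terminal (b + e) w)%:E <=
   P (\big[setU/set0]_(k < n) beyond b k))%E.
Proof.
move=> tT.
have mF k : measurable (seqDU (beyond b) k).
  by apply: past_measurable; exact: past_first_beyond.
have mG k : measurable (first_beyond_near b e k).
  by apply: past_measurable; exact: past_first_beyond_near.
have tF (D : set nat) : trivIset D (seqDU (beyond b)).
  exact: sub_trivIset (@trivIset_seqDU _ (beyond b)).
have mt : measurable_fun [set: Omega] (fun w => (terminal (b + e) w)%:E) by exact: measurable_terminal.
rewrite -(big_mkord xpredT (first_beyond_near b e)).
rewrite ge0_integral_bigsetU//; last 4 first.
- exact: iota_uniq.
- exact: trivIset_setIr.
- exact: measurable_funTS.
- by move=> w _; rewrite lee_fin reflection_weight_ge0.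
rewrite (bigsetU_seqDU (beyond b)) (@measure_bigsetU _ _ _ P (seqDU (beyond b)) mF (tF _)).
rewrite big_mkord; apply: lee_sum => k _.
apply: (@le_trans _ _ (P (first_beyond_near b e k))).
  apply: past_within_ge; first exact: tT.
    exact: past_first_beyond_near.
  by move=> w [].
by apply: le_measure; rewrite ?inE//; exact: subIsetl.
Qed.

End discrete_reflection.

(** * Passage from grids to continuous time *)

(** Fatou's lemma, in the form used for all the limits below. *)
Lemma integral_le_of_cvg d (T : measurableType d) (R : realType)
    (mu : {measure set T -> \bar R}) (f_ : nat -> T -> \bar R) (f : T -> \bar R)
    (C : \bar R) :
  (forall n, measurable_fun [set: T] (f_ n)) -> (forall n x, 0 <= f_ n x)%E ->
  (forall x, f_ n x @[n --> \oo] --> f x) ->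
  (forall n, \int[mu]_x f_ n x <= C)%E -> (\int[mu]_x f x <= C)%E.
Proof.
move=> mf f0 ff fC.
have -> : (\int[mu]_x f x = \int[mu]_x limn_einf (f_ ^~ x))%E.
  by apply: eq_integral => x _; have [-> _] := cvg_limn_einf_sup (ff x).
apply: (@le_trans _ _ (limn_einf (fun n => \int[mu]_x f_ n x)%E)); first exact: fatou.
rewrite limn_einf_lim; apply: lime_le; first exact: is_cvg_einfs.
apply: nearW => n; apply: (le_trans _ (fC n)).
by apply: ereal_inf_lbound; exists n => /=.
Qed.

Lemma integral_le_of_eventually d (T : measurableType d) (R : realType)
    (mu : {measure set T -> \bar R}) (f : T -> \bar R) (A : nat -> set T)
    (C : \bar R) :
  measurable_fun [set: T] f -> (forall x, 0 <= f x)%E ->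
  (forall n, measurable (A n)) ->
  (forall x, f x != 0%E -> \forall n \near \oo, A n x) ->
  (forall n, \int[mu]_(x in A n) f x <= C)%E -> (\int[mu]_x f x <= C)%E.
Proof.
move=> mf f0 mA fA fC; apply: (@integral_le_of_cvg _ _ _ _ (fun n => f \_ (A n))).
- by move=> n; apply: (measurable_restrictT _ _).1 => //; exact: measurable_funTS.
- by move=> n x; rewrite patchE; case: ifP.
- move=> x; apply: cvg_near_cst; have [fx0|fx] := eqVneq (f x) 0%E.
    by apply: nearW => n; rewrite patchE; case: ifP; rewrite fx0.
  by apply: filterS (fA x fx) => n Anx; rewrite patchE mem_set.
- by move=> n; rewrite -integral_mkcond.
Qed.

(** Heine's theorem. *)
Lemma unif_continuous_segment (R : realType) (f : R -> R) (a b e : R) :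
  {within `[a, b], continuous f} -> 0 < e ->
  exists2 r, 0 < r & forall x y, x \in `[a, b] -> y \in `[a, b] ->
    `|x - y| < r -> `|f x - f y| < e.
Proof.
move=> /subspace_continuousP cf e0.
have /compact_near_coveringP/near_covering_withinP cov := @segment_compact R a b.
pose close (r x : R) := forall y, y \in `[a, b] -> `|x - y| < r -> `|f x - f y| < e.
have [] : \forall r \near (0 : R)^'+, `[a, b]%classic `<=` close r.
  apply: cov => x Kx.
  have e2 : 0 < e / 2 by rewrite divr_gt0.
  have /cvgrPdist_lt/(_ _ e2) := cf x Kx.
  rewrite near_withinE => -[r /= r0 fr].
  have r2 : 0 < r / 2 by rewrite divr_gt0.
  exists (ball x (r / 2), [set s | s < r / 2]); first split.
  - exact: nbhsx_ballx.
  - exact: nbhs_right_lt.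
  - move=> [x' s] /= [xx' sr] Kx' y Ky x'y.
    have := ler_distD (f x) (f x') (f y).
    have fxy : `|f x - f y| < e / 2.
      apply: fr => //=; have := ler_distD x' x y; move: xx'; rewrite /ball/=; lra.
    have fxx' : `|f x - f x'| < e / 2.
      by apply: fr => //=; move: xx'; rewrite /ball/=; lra.
    by rewrite (distrC (f x') (f x)); lra.
move=> r /= r0 Kr; exists (r / 2); first by rewrite divr_gt0.
move=> x y Kx; apply: (Kr (r / 2)) => //=.
  by rewrite sub0r normrN gtr0_norm ?divr_gt0// ltr_pdivrMr// ltr_pMr// ltr1n.
by rewrite divr_gt0.
Qed.

Definition grid {R : realType} (T : R) (n k : nat) : R := T * (k%:R / n.+1%:R).

Lemma grid0 (R : realType) (T : R) n : grid T n 0 = 0.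
Proof. by rewrite /grid mul0r mulr0. Qed.

Lemma grid_last (R : realType) (T : R) n : grid T n n.+1 = T.
Proof. by rewrite /grid divff ?mulr1// pnatr_eq0. Qed.

Lemma grid_nondecreasing (R : realType) (T : R) n :
  0 < T -> nondecreasing_seq (grid T n).
Proof.
move=> T0 i j ij; rewrite /grid ler_wpM2l ?(ltW T0)// ler_wpM2r ?ler_nat//.
Qed.

Lemma grid_itv (R : realType) (T : R) n k :
  0 < T -> (k < n.+2)%N -> grid T n k \in `[0, T].
Proof.
move=> T0 kn; rewrite in_itv/= -(grid0 T n) grid_nondecreasing//=.
by rewrite -[leRHS](grid_last T n) grid_nondecreasing.
Qed.

Lemma gridS (R : realType) (T : R) n k :
  grid T n k.+1 - grid T n k = T * n.+1%:R^-1.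
Proof. by rewrite /grid -mulrBr -mulrBl -natrB// subSnn mul1r. Qed.

Lemma grid_mesh (R : realType) (T r : R) : 0 < T -> 0 < r ->
  \forall n \near \oo, T * n.+1%:R^-1 < r.
Proof.
move=> T0 r0; have rT : 0 < r / T by rewrite divr_gt0.
by apply: filterS (near_infty_natSinv_lt (PosNum rT)) => n /=; rewrite ltr_pdivlMr// mulrC.
Qed.

Section crossing.
Context (R : realType) (d : measure_display) (Omega : measurableType d).
Context (P : probability Omega R) (B : R -> {RV P >-> R}).
Context (hB : standard_brownian_motion B).
Context (T c : R).
Context (T0 : 0 < T) (c0 : 0 < c).

Definition crossing (b : R) : set Omega :=
  [set w | exists2 s, s \in `[0, T] & b + c * s < B s w].

Definition grid_crossing (b : R) (n : nat) : set Omega :=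
  \big[setU/set0]_(k < n.+2) beyond B (grid T n) c b k.

Lemma path_unif_continuous (b e : R) (w : Omega) : 0 < e ->
  exists2 r, 0 < r & forall x y, x \in `[0, T] -> y \in `[0, T] -> `|x - y| < r ->
    `|(b + c * x - B x w) - (b + c * y - B y w)| < e.
Proof.
move=> e0; apply: unif_continuous_segment => //.
apply: within_continuousB.
  apply: continuous_subspaceT => x; apply: cvgD; first exact: cvg_cst.
  by apply: cvgM; [exact: cvg_cst|exact: cvg_id].
have : {within `[0, +oo[, continuous (fun s => B s w)} by exact: sbm_continuous.
apply: continuous_subspaceW => x /=.
by rewrite !in_itv/= andbT => /andP[].
Qed.

Lemma grid_crossing_sub (b : R) (n : nat) : grid_crossing b n `<=` crossing b.
Proof.
move=> w; rewrite /grid_crossing -bigcup_mkord => -[k /= kn]; rewrite /beyond /gap /= => gw.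
by exists (grid T n k); [exact: grid_itv|lra].
Qed.

(** The path stays above the barrier near a crossing time, and a fine grid has a
    point there. *)
Lemma near_grid_crossing (b : R) (w : Omega) :
  crossing b w -> \forall n \near \oo, grid_crossing b n w.
Proof.
move=> [s sT bs].
have e0 : 0 < B s w - (b + c * s) by rewrite subr_gt0.
have [r r0 gr] := path_unif_continuous b w e0.
apply: filterS (grid_mesh T0 r0) => n nr.
pose x := s / T * n.+1%:R.
have n0 : 0 < n.+1%:R :> R by rewrite ltr0n.
move: (sT); rewrite in_itv/= => /andP[s0 sleT].
have x0 : 0 <= x by rewrite mulr_ge0 ?divr_ge0 ?(ltW T0).
have := truncn_itv x0; set k := Num.truncn x => /andP[kx xk].
have kn : (k < n.+2)%N.
  by rewrite ltnS -(ler_nat R) (le_trans kx)// ler_piMl ?(ltW n0)// ler_pdivrMr// mul1r.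
have sE : s = T * (x / n.+1%:R) by rewrite /x; field; rewrite gt_eqF//= gt_eqF.
have ks : grid T n k <= s.
  by rewrite sE /grid ler_wpM2l ?(ltW T0)// ler_wpM2r ?invr_ge0 ?(ltW n0).
have sk : s < grid T n k.+1.
  by rewrite sE /grid ltr_pM2l// ltr_pM2r ?invr_gt0.
rewrite /grid_crossing -bigcup_mkord; exists k => //=.
have := gr _ _ sT (grid_itv T0 kn).
rewrite /beyond/= /gap ger0_norm ?subr_ge0//.
move=> gsk; have /gsk : s - grid T n k < r.
  by rewrite (lt_trans _ nr)// -(gridS T n k) ltrD2r.
by rewrite ltr_norml => /andP[]; lra.
Qed.

Lemma measurable_grid_crossing (b : R) (n : nat) : measurable (grid_crossing b n).
Proof.
apply: bigsetU_measurable => k _.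
rewrite (_ : beyond _ _ _ _ _ = setT `&` gap B (grid T n) c b k @^-1` `]-oo, 0[).
  apply: measurable_funB => //; exact: measurable_cst.
by apply/seteqP; split => w /=; rewrite /beyond/= in_itv/= => //; case.
Qed.

Lemma crossing_bigcup (b : R) : crossing b = \bigcup_n grid_crossing b n.
Proof.
apply/seteqP; split => [w cw|w [n _]]; last exact: grid_crossing_sub.
by have [n _ /(_ n (leqnn n)) gw] := near_grid_crossing cw; exists n.
Qed.

Lemma measurable_crossing (b : R) : measurable (crossing b).
Proof.
by rewrite crossing_bigcup; apply: bigcupT_measurable => n; exact: measurable_grid_crossing.
Qed.

Let terminal (b : R) (w : Omega) : R := reflection_weight c (b + c * T - B T w).

Lemma crossing_le (b : R) : (P (crossing b) <= \int[P]_w (terminal b w)%:E)%E.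
Proof.
have mC := measurable_crossing b.
rewrite -(setIT (crossing b)) -integral_indic//.
apply: (integral_le_of_eventually (A := grid_crossing b)).
- by apply/measurable_EFinP; exact: measurable_indic.
- by move=> w; rewrite lee_fin.
- by move=> n; exact: measurable_grid_crossing.
- move=> w; rewrite indicE; case: (boolP (w \in _)) => [|_]; last by rewrite eqxx.
  by rewrite inE => cw _; exact: near_grid_crossing.
- move=> n; have mg := measurable_grid_crossing b n.
  rewrite integral_indic// setIidr; last exact: grid_crossing_sub.
  apply: (discrete_crossing_le hB) => //.
  + exact: grid0.
  + exact: grid_nondecreasing.
  + by move=> k kn; have := grid_itv T0 kn; rewrite in_itv => /andP[].
Qed.

(** A path that ends beyond the barrier [b + e] crosses [b] on every grid;
    just before the first grid crossing the gap is nonnegative, so on a fine grid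
    it is at least [- e] one step later. *)
Lemma near_first_beyond_near (b e : R) (w : Omega) : 0 < b -> 0 < e ->
  b + e + c * T < B T w ->
  \forall n \near \oo,
    (\big[setU/set0]_(k < n.+2) first_beyond_near B (grid T n) c b e k) w.
Proof.
move=> b0 e0 bT; have [r r0 gr] := path_unif_continuous b w e0.
apply: filterS (grid_mesh T0 r0) => n nr.
have exk : exists k, gap B (grid T n) c b k w < 0.
  by exists n.+1; rewrite /gap grid_last; lra.
case: (ex_minnP exk) => k gk kmin.
have kn : (k < n.+2)%N by apply: kmin; rewrite /gap grid_last; lra.
rewrite -bigcup_mkord; exists k => //; split.
  split => //; rewrite -bigcup_mkord => -[j /= jk gj].
  by have := kmin j gj; rewrite leqNgt jk.
case: k gk kmin kn => [|k] gk kmin kn.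
  by move: gk; rewrite /gap grid0 (sbm_start hB) mulr0; lra.
have gk' : 0 <= gap B (grid T n) c b k w.
  by rewrite leNgt; apply/negP => /kmin; rewrite ltnn.
have := gr _ _ (grid_itv T0 kn) (grid_itv T0 (ltnW kn)).
rewrite gridS ger0_norm ?mulr_ge0 ?invr_ge0 ?(ltW T0)// => /(_ nr).
by move: gk'; rewrite /gap/= ltr_norml => ? /andP[]; lra.
Qed.

Lemma crossing_ge (b e : R) : 0 < b -> 0 < e ->
  (\int[P]_w (terminal (b + e) w)%:E <= P (crossing b))%E.
Proof.
move=> b0 e0; have mC := measurable_crossing b.
have tnd n := grid_nondecreasing n T0.
apply: (integral_le_of_eventually
  (A := fun n => \big[setU/set0]_(k < n.+2) first_beyond_near B (grid T n) c b e k)).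
- by exact: measurable_terminal.
- by move=> w; rewrite lee_fin reflection_weight_ge0.
- move=> n; apply: bigsetU_measurable => k _.
  by apply: past_measurable; apply: (past_first_beyond_near hB) => //; exact: grid0.
- move=> w; rewrite /terminal /reflection_weight.
  case: ifPn => [h _|_]; last by rewrite eqxx.
  by apply: near_first_beyond_near => //; lra.
- move=> n; apply: (@le_trans _ _ (P (grid_crossing b n))).
    apply: (discrete_crossing_ge hB) => //.
    + exact: grid0.
    + by move=> k kn; have := grid_itv T0 kn; rewrite in_itv => /andP[].
  apply: le_measure; rewrite ?inE//; first exact: measurable_grid_crossing.
  exact: grid_crossing_sub.
Qed.

End crossing.

(** * The crossing probability and its asymptotics *)

Section crossing_probability.
Context (R : realType) (d : measure_display) (Omega : measurableType d).
Context (P : probability Omega R) (B : R -> {RV P >-> R}).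
Context (hB : standard_brownian_motion B).
Context (T c : R).
Context (T0 : 0 < T) (c0 : 0 < c).

(** The lower bound [crossing_ge] is for the barrier raised by [e]; let [e] tend
    to 0. *)
Lemma crossing_integral (b : R) : 0 < b ->
  P (crossing B T c b) =
  (\int[P]_w (reflection_weight c (b + c * T - B T w))%:E)%E.
Proof.
move=> b0; apply/eqP; rewrite eq_le crossing_le//=.
apply: (@integral_le_of_cvg _ _ _ _
  (fun n w => (reflection_weight c (b + n.+1%:R^-1 + c * T - B T w))%:E)).
- by move=> n; exact: measurable_terminal.
- by move=> n w; rewrite lee_fin reflection_weight_ge0.
- move=> w; pose y := b + c * T - B T w.
  rewrite (_ : (fun n => _) = EFin \o (fun n => reflection_weight c (y + n.+1%:R^-1))).
    by apply: cvg_EFin; [exact: nearW|exact: reflection_weight_cvg_right].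
  by apply/funext => n /=; congr (reflection_weight c _)%:E; rewrite /y; ring.
- by move=> n; apply: crossing_ge.
Qed.

(** The Bachelier-Levy formula, with the survival functions written as normal
    tails. *)
Lemma crossing_probE (b : R) : 0 < b ->
  (P (crossing B T c b) =
   normal_prob 0 (Num.sqrt T) `](b + c * T)%R, +oo[ +
   (expR (- (2 * c * b)))%:E *
     normal_prob (2 * c * T) (Num.sqrt T) `](b + c * T)%R, +oo[)%E.
Proof.
move=> b0; rewrite crossing_integral//.
have := @integral_reflection_weight R c T (b + c * T) T0; rewrite addrK => <-.
(* the law of [B T]: its increment from time 0, on the whole space *)
have := @integral_past_indep _ _ _ _ _ hB (fun=> 0) 0%N T
  (fun x => (reflection_weight c (b + c * T - x))%:E) setT.
rewrite subr0 probability_setT mul1e => <-//.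
- by apply: eq_integral => w _; rewrite (sbm_start hB) subr0.
- exact: (@measurableT _ (g_sigma_algebraType (past_cylinders B (fun=> 0) 0))).
- apply/measurable_EFinP; apply: measurableT_comp; first exact: measurable_reflection_weight.
  exact: measurable_funB.
- by move=> x; rewrite lee_fin reflection_weight_ge0.
Qed.

Let peak := normal_peak (Num.sqrt T).
Let decay (b : R) := expR (- ((b + c * T) ^+ 2 / (2 * T))).

Let decayE (b : R) : expR (- (2 * c * b)) *
  expR (- ((b + c * T - 2 * c * T) ^+ 2 / (2 * T))) = decay b.
Proof.
by rewrite -expRD /decay; congr expR; field; rewrite gt_eqF.
Qed.

Lemma crossing_prob_le (b : R) : 0 < b -> c * T < b ->
  fine (P (crossing B T c b)) <=
  peak * decay b * (T / (b + c * T) + T / (b - c * T)).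
Proof.
move=> b0 cTb; rewrite -lee_fin fineK; last first.
  by apply: fin_num_measure; exact: measurable_crossing.
have cT0 : 0 < c * T by rewrite mulr_gt0.
rewrite crossing_probE//.
have h1 : 0 < b + c * T by rewrite addr_gt0.
have h2 : 2 * c * T < b + c * T by lra.
apply: (le_trans (leeD (normal_tail_le T0 h1) (lee_wpmul2l _ (normal_tail_le T0 h2)))).
  by rewrite lee_fin expR_ge0.
rewrite -EFinM -EFinD lee_fin subr0 -/peak -/(decay b).
rewrite [expR (- (2 * c * b)) * _]mulrCA decayE.
rewrite (_ : b + c * T - 2 * c * T = b - c * T); last by ring.
by rewrite le_eqVlt; apply/orP; left; apply/eqP; ring.
Qed.

Lemma crossing_prob_ge (b : R) : 0 < b -> c * T < b ->
  peak * decay b * (T * (b + c * T) / ((b + c * T) ^+ 2 + T) +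
                    T * (b - c * T) / ((b - c * T) ^+ 2 + T)) <=
  fine (P (crossing B T c b)).
Proof.
move=> b0 cTb; rewrite -lee_fin fineK; last first.
  by apply: fin_num_measure; exact: measurable_crossing.
have cT0 : 0 < c * T by rewrite mulr_gt0.
rewrite crossing_probE//.
have h1 : 0 < b + c * T by rewrite addr_gt0.
have h2 : 2 * c * T < b + c * T by lra.
apply: (le_trans _ (leeD (normal_tail_ge T0 h1) (lee_wpmul2l _ (normal_tail_ge T0 h2)))); last first.
  by rewrite lee_fin expR_ge0.
rewrite -EFinM -EFinD lee_fin subr0 -/peak -/(decay b).
rewrite [expR (- (2 * c * b)) * _]mulrCA decayE.
rewrite (_ : b + c * T - 2 * c * T = b - c * T); last by ring.
by rewrite le_eqVlt; apply/orP; left; apply/eqP; ring.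
Qed.

End crossing_probability.

Section reduction.
Context (R : realType) (d : measure_display) (Omega : measurableType d).
Context (P : probability Omega R) (B : R -> {RV P >-> R}).
Context (hB : standard_brownian_motion B).
Context (T : R).
Context (T0 : 0 < T).

(** The supremum is that of a nonempty set, bounded because the path is continuous. *)
Lemma lt_sup_drifted (c x : R) (w : Omega) :
  x < sup_drifted B T c w <->
  exists2 s, s \in `[0, T] & x < B s w - c * s.
Proof.
pose S := [set B s w - c * s | s in `[0, T]].
have S0 : S !=set0.
  by exists (B 0 w - c * 0); exists 0 => //=; rewrite in_itv/= lexx ltW.
have Sub : has_ubound S.
  have cont : {within `[0, T], continuous (fun s => B s w - c * s)}.
    apply: within_continuousB.
      have : {within `[0, +oo[, continuous (fun s => B s w)} by exact: sbm_continuous.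
      apply: continuous_subspaceW => s /=.
      by rewrite !in_itv/= andbT => /andP[].
    apply: continuous_subspaceT => s.
    by apply: cvgM; [exact: cvg_cst|exact: cvg_id].
  have [m _ mP] := EVT_max (ltW T0) cont.
  by exists (B m w - c * m) => _ [s sT <-]; exact: mP.
split.
- move=> /(sup_gt S0)[_ [s sT <-] xs]; first by exists s.
- move=> [s sT xs]; apply: (lt_le_trans xs); apply: ub_le_sup => //.
  by exists s.
Qed.

Lemma joint_ruin_probE (c1 c2 a b : R) : c2 < c1 ->
  (c1 - c2) * T <= (1 - a) * b ->
  joint_ruin_prob B T c1 c2 (a * b) b = fine (P (crossing B T c2 b)).
Proof.
move=> c12 bT; congr (fine (P _)); apply/seteqP; split => w /=.
  by move=> [_ /lt_sup_drifted[s sT bs]]; exists s => //; lra.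
move=> [s sT bs]; split; apply/lt_sup_drifted; exists s => //; last by lra.
move: (sT); rewrite in_itv/= => /andP[s0 sleT].
have : (c1 - c2) * s <= (c1 - c2) * T by rewrite ler_wpM2l// subr_ge0 ltW.
by lra.
Qed.

End reduction.

Lemma sqrt_peak (R : realType) (T : R) : 0 < T ->
  Num.sqrt (2 * T / pi) = 2 * T * normal_peak (Num.sqrt T).
Proof.
move=> T0; have pi0 := @pi_gt0 R.
have x0 : 0 <= 2 * T * normal_peak (Num.sqrt T).
  by rewrite !mulr_ge0 ?(ltW T0) ?normal_peak_ge0.
rewrite -[RHS](ger0_norm x0) -sqrtr_sqr; congr Num.sqrt.
rewrite /normal_peak sqr_sqrtr ?(ltW T0)// exprMn exprVn sqr_sqrtr; last first.
  by rewrite mulrn_wge0// mulr_ge0 ?(ltW T0) ?(ltW pi0).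
have T0' : T != 0 by rewrite gt_eqF.
have pi0' : (pi : R) != 0 by rewrite gt_eqF.
rewrite -mulr_natr; move: (pi : R) pi0' => p p0.
by field; rewrite T0' p0.
Qed.

Lemma cvg_affine_inv (R : realType) (q : R) :
  1 + q * b^-1 @[b --> +oo] --> (1 : R).
Proof.
rewrite -[X in _ --> X]addr0; apply: cvgD; first exact: cvg_cst.
rewrite -[X in _ --> X](mulr0 q); apply: cvgM; first exact: cvg_cst.
have pos : \forall x \near +oo, 0 < (x : R).
  by apply: nbhs_pinfty_gt; exact: num_real.
by apply/(gtr0_cvgV0 pos); exact: cvg_id.
Qed.

Lemma cvg_mills_upper (R : realType) (q : R) :
  b / 2 * ((b + q)^-1 + (b - q)^-1) @[b --> +oo] --> (1 : R).
Proof.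
have lim : 2^-1 * ((1 + q * b^-1)^-1 + (1 + - q * b^-1)^-1) @[b --> +oo] --> (1 : R).
  rewrite [X in _ --> X](_ : _ = 2^-1 * (1^-1 + 1^-1)); last by field.
  apply: cvgM; first exact: cvg_cst.
  by apply: cvgD; apply: cvgV; rewrite ?oner_neq0//; exact: cvg_affine_inv.
apply: cvg_trans lim; apply: near_eq_cvg; near=> b.
  have b0 : 0 < b by near: b; apply: nbhs_pinfty_gt; exact: num_real.
  have bq : q < b by near: b; apply: nbhs_pinfty_gt; exact: num_real.
  have bq' : - q < b by near: b; apply: nbhs_pinfty_gt; exact: num_real.
  have b0' : b != 0 by rewrite gt_eqF.
  have h1 : b + q != 0 by rewrite gt_eqF//; lra.
  have h2 : b - q != 0 by rewrite gt_eqF//; lra.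
  by field; rewrite h2 h1 b0'.
Unshelve. all: by end_near. Qed.

Lemma cvg_mills_lower (R : realType) (q T : R) : 0 < T ->
  b / 2 * ((b + q) / ((b + q) ^+ 2 + T) + (b - q) / ((b - q) ^+ 2 + T))
    @[b --> +oo] --> (1 : R).
Proof.
move=> T0.
have half (p : R) : (1 + p * b^-1) * ((1 + p * b^-1) ^+ 2 + T * (b^-1 * b^-1))^-1
    @[b --> +oo] --> (1 : R).
  rewrite [X in _ --> X](_ : _ = 1 * (1 ^+ 2 + T * (0 * 0))^-1); last by field.
  apply: cvgM; first exact: cvg_affine_inv.
  apply: cvgV; first by rewrite expr1n !mulr0 addr0 oner_neq0.
  have inv0 : b^-1 @[b --> +oo] --> (0 : R).
    have pos : \forall x \near +oo, 0 < (x : R).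
      by apply: nbhs_pinfty_gt; exact: num_real.
    by apply/(gtr0_cvgV0 pos); exact: cvg_id.
  apply: cvgD.
    apply: (cvg_comp (fun b => 1 + p * b^-1) (fun x => x ^+ 2)); last exact: sqr_continuous.
    exact: cvg_affine_inv.
  apply: cvgM; first exact: cvg_cst.
  exact: cvgM.
have lim : 2^-1 * ((1 + q * b^-1) * ((1 + q * b^-1) ^+ 2 + T * (b^-1 * b^-1))^-1
   + (1 + - q * b^-1) * ((1 + - q * b^-1) ^+ 2 + T * (b^-1 * b^-1))^-1)
   @[b --> +oo] --> (1 : R).
  rewrite [X in _ --> X](_ : _ = 2^-1 * (1 + 1)); last by field.
  by apply: cvgM; [exact: cvg_cst|apply: cvgD; exact: half].
apply: cvg_trans lim; apply: near_eq_cvg; near=> b.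
  have b0 : 0 < b by near: b; apply: nbhs_pinfty_gt; exact: num_real.
  have b0' : b != 0 by rewrite gt_eqF.
  have half_eq (p : R) : (1 + p * b^-1) * ((1 + p * b^-1) ^+ 2 + T * (b^-1 * b^-1))^-1 =
      b * ((b + p) / ((b + p) ^+ 2 + T)).
    have h : (b + p) ^+ 2 + T != 0 by rewrite gt_eqF// ltr_wpDl ?sqr_ge0.
    by field; rewrite b0' h.
  by rewrite !half_eq -mulrDr mulrA (mulrC 2^-1).
Unshelve. all: by end_near. Qed.

Unset Implicit Arguments.

Theorem theorem2p3 (R : realType) (d : measure_display)
    (Omega : measurableType d) (P : probability Omega R)
    (B : R -> {RV P >-> R}) (hB : standard_brownian_motion B)
    (T c1 c2 a : R) (hT : 0 < T) (hc2 : 0 < c2) (hc12 : c2 < c1)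
    (ha0 : 0 < a) (ha1 : a < 1) :
  joint_ruin_prob B T c1 c2 (a * b) b /
    (Num.sqrt (2 * T / pi) * b^-1 * expR (- ((b + c2 * T) ^+ 2 / (2 * T))))
    @[b --> +oo] --> (1 : R).
Proof.
apply: (@squeeze_cvgr _ _ _ _
  (fun b => b / 2 * ((b + c2 * T) / ((b + c2 * T) ^+ 2 + T) +
                     (b - c2 * T) / ((b - c2 * T) ^+ 2 + T)))
  (fun b => b / 2 * ((b + c2 * T)^-1 + (b - c2 * T)^-1)));
  [|exact: cvg_mills_lower|exact: cvg_mills_upper].
near=> b.
have b0 : 0 < b by near: b; apply: nbhs_pinfty_gt; exact: num_real.
have cTb : c2 * T < b by near: b; apply: nbhs_pinfty_gt; exact: num_real.
have b1 : (c1 - c2) * T / (1 - a) < b by near: b; apply: nbhs_pinfty_gt; exact: num_real.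
have a1 : 0 < 1 - a by rewrite subr_gt0.
rewrite (@joint_ruin_probE _ _ _ _ _ hB)//; last first.
  by rewrite (mulrC (1 - a)) -ler_pdivrMr// ltW.
have cT0 : 0 < c2 * T by rewrite mulr_gt0.
have ss0 : Num.sqrt T != 0 by rewrite gt_eqF ?sqrtr_gt0.
have k0 := normal_peak_gt0 ss0.
rewrite sqrt_peak//.
have ub := crossing_prob_le hB hT hc2 b0 cTb.
have lb := crossing_prob_ge hB hT hc2 b0 cTb.
set k := normal_peak _ in ub lb k0 *.
set e := expR _ in ub lb *.
have e0 : 0 < e by exact: expR_gt0.
have b0' : b != 0 by rewrite gt_eqF.
have hT' : T != 0 by rewrite gt_eqF.
have k0' : k != 0 by rewrite gt_eqF.
have e0' : e != 0 by rewrite gt_eqF.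
have D0 : 0 < 2 * T * k * b^-1 * e by rewrite mulr_gt0// mulr_gt0 ?invr_gt0// mulr_gt0// mulr_gt0.
apply/andP; split.
  rewrite ler_pdivlMr//; apply: le_trans lb; rewrite le_eqVlt; apply/orP; left; apply/eqP.
  have h1 : (b + c2 * T) ^+ 2 + T != 0 by rewrite gt_eqF// ltr_wpDl ?sqr_ge0.
  have h2 : (b - c2 * T) ^+ 2 + T != 0 by rewrite gt_eqF// ltr_wpDl ?sqr_ge0.
  by field; rewrite b0' h1 h2.
rewrite ler_pdivrMr//; apply: (le_trans ub); rewrite le_eqVlt; apply/orP; left; apply/eqP.
have h1 : b + c2 * T != 0 by rewrite gt_eqF// addr_gt0.
have h2 : b - c2 * T != 0 by rewrite gt_eqF// subr_gt0.
by field; rewrite b0' h1 h2.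
Unshelve. all: by end_near. Qed.
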